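(* Let $B$ be a $k$-adjacency basis of a graph $G=(V,E)$, and let $G'=(V,E')$ be any graph on the same vertex set such that $N_{G'}(x)=N_G(x)$ for every $x\in B$. Then $B$ is a $k$-adjacency generator for $G'$, and consequently $\operatorname{adim}_k(G')\le\operatorname{adim}_k(G)$.
   Context: All graphs are finite and simple; $N_G(x)$ is the open neighbourhood of $x$ in $G$. For a graph $G=(V,E)$, $d_{G,2}(x,y)=\min\{d_G(x,y),2\}$ with $d_G$ the shortest-path distance ($\infty$ between different components). For distinct $x,y$, $\mathcal{C}_G(x,y)=\{z\in V: d_{G,2}(x,z)\ne d_{G,2}(y,z)\}$. A set $S\subseteq V$ is a $k$-adjacency generator if $|S\cap\mathcal{C}_G(x,y)|\ge k$ for all distinct $x,y$; a minimum-cardinality one is a $k$-adjacency basis and its size is $\operatorname{adim}_k(G)$. *)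

(* Defs.v *)
From HB Require Import structures.
From mathcomp Require Import all_boot.

Set Implicit Arguments.
Unset Strict Implicit.
Unset Printing Implicit Defensive.

Record sgraph (V : finType) := SGraph {
  adj :> rel V;
  adj_sym : symmetric adj;
  adj_irr : irreflexive adj }.

Section AdjacencyDimension.

Variables (V : finType) (G : sgraph V).
Implicit Types (x y z : V) (S B : {set V}) (k n : nat).

Definition neigh x : {set V} := [set y | G x y].

Definition has_path n x y : bool :=
  [exists p : n.-tuple V, [&& path G x p, uniq (x :: p) & last x p == y]].

(** [None] stands for infinite distance.  A path repeats no vertex, so only
    lengths below [#|V|] need to be searched (see [distP]). *)
Definition dist x y : option nat :=
  ohead [seq n <- iota 0 #|V| | has_path n x y].

Definition dist2 x y : nat := if dist x y is Some n then minn n 2 else 2.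

Definition distinguish x y : {set V} := [set z | dist2 x z != dist2 y z].

Definition adj_generator k S : bool :=
  [forall x, forall y, (x != y) ==> (k <= #|S :&: distinguish x y|)].

Definition adj_basis k B : bool :=
  adj_generator k B && [forall S, adj_generator k S ==> (#|B| <= #|S|)].

(** If [G] has no [k]-adjacency generator, the value is the junk [#|V|]. *)
Definition adim k : nat :=
  #|[arg min_(S < [set: V] | adj_generator k S) #|S|]|.

Lemma distP x y :
  match dist x y with
  | Some n => has_path n x y /\ (forall m, has_path m x y -> n <= m)
  | None => forall m, ~~ has_path m x y
  end.
Proof.
have bnd m : has_path m x y -> m < #|V|.
  case/existsP=> p /and3P[_ Up _].
  by have := max_card [in x :: p]; rewrite (card_uniqP Up) /= size_tuple.
rewrite /dist.
have memE m : (m \in [seq n <- iota 0 #|V| | has_path n x y]) = has_path m x y.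
  rewrite mem_filter mem_iota /= add0n.
  by case H: (has_path m x y); rewrite //= bnd.
have : sorted ltn [seq n <- iota 0 #|V| | has_path n x y].
  by apply: sorted_filter; [exact: ltn_trans | exact: iota_ltn_sorted].
case: [seq _ <- _ | _] memE => [|n s] memE /= srt.
  by move=> m; rewrite -memE.
split=> [|m]; first by rewrite -memE inE eqxx.
rewrite -memE inE => /predU1P[-> //|ms].
by have /allP/(_ m ms)/ltnW := order_path_min ltn_trans srt.
Qed.

Lemma adim_basis k B : adj_basis k B -> adim k = #|B|.
Proof.
case/andP=> genB /forallP minB.
have genT : adj_generator k [set: V].
  apply/'forall_forallP=> x y; apply/implyP=> xy.
  move/'forall_forallP: genB => /(_ x y)/implyP/(_ xy)/leq_trans; apply.
  by rewrite subset_leq_card // setSI // subsetT.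
rewrite /adim; case: arg_minnP => // S genS minS.
by apply/eqP; rewrite eqn_leq minS //= (implyP (minB S)).
Qed.

End AdjacencyDimension.

(* Main.v *)
(** Truncation at 2 makes the distance local: [dist2 x y] is 0, 1 or 2 according
    to whether [x = y], [x] is adjacent to [y], or neither.  Hence whether
    [z \in B] distinguishes [x] and [y] depends only on the neighbourhood of [z],
    and [G] and [G'] have the same distinguishing sets inside [B]. *)
Require Import Defs.
From HB Require Import structures.
From mathcomp Require Import all_boot.

Set Implicit Arguments.
Unset Strict Implicit.
Unset Printing Implicit Defensive.

Lemma has_path0 (V : finType) (G : sgraph V) (x y : V) :
  has_path G 0 x y = (x == y).
Proof.
apply/existsP/idP => [[p]|xy]; first by rewrite tuple0 => /and3P[].
by exists [tuple]; rewrite /= xy.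
Qed.

Lemma has_path1 (V : finType) (G : sgraph V) (x y : V) :
  has_path G 1 x y = G x y.
Proof.
apply/existsP/idP => [[p]|Gxy].
  case/tupleP: p => z p; rewrite tuple0 /= andbT.
  by case/and3P=> Gxz _ /eqP <-.
exists [tuple y]; rewrite /= Gxy eqxx inE !andbT /=.
by apply: contraTneq Gxy => ->; rewrite adj_irr.
Qed.

(** Paths of length 0 and 1 encode equality and adjacency; any other shortest path has length at
    least 2, and truncation gives it the same value as infinite distance. *)
Lemma dist2E (V : finType) (G : sgraph V) (x y : V) :
  dist2 G x y = if x == y then 0 else if G x y then 1 else 2.
Proof.
(* Both tests become [has_path] statements, to which the minimality in [distP] applies. *)
have := distP G x y; rewrite /dist2 -(has_path0 G) -has_path1.
case: (dist G x y) => [n [path_n min_n]|no_path]; last first.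
  by rewrite !(negPf (no_path _)).
case: ifPn => [/min_n|no0]; first by rewrite leqn0 => /eqP ->.
case: ifPn => [/min_n|no1]; first by case: n path_n {min_n} no0 => [->|[]].
by case: n path_n {min_n} => [|[|n]] path_n; rewrite ?path_n in no0 no1 *.
Qed.

Lemma dist2_neigh (V : finType) (G G' : sgraph V) (x z : V) :
  neigh G' z = neigh G z -> dist2 G' x z = dist2 G x z.
Proof. by move/setP/(_ x); rewrite !inE !dist2E !(adj_sym _ x z) => ->. Qed.

Lemma adj_generator_neigh (V : finType) (k : nat) (G G' : sgraph V)
    (S : {set V}) :
  {in S, forall x, neigh G' x = neigh G x} ->
  adj_generator G k S -> adj_generator G' k S.
Proof.
move=> eqN /'forall_forallP genS; apply/'forall_forallP => x y.
suff -> : S :&: distinguish G' x y = S :&: distinguish G x y by [].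
(* Only [z] in [S] has to be compared; outside [S] the distinguishing sets may differ. *)
apply/setP=> z; rewrite !inE; apply: andb_id2l => /eqN eqNz.
by rewrite !(dist2_neigh _ eqNz).
Qed.

Lemma adj_generator_sub (V : finType) (k : nat) (G : sgraph V)
    (S T : {set V}) :
  S \subset T -> adj_generator G k S -> adj_generator G k T.
Proof.
move=> sST /'forall_forallP genS; apply/'forall_forallP => x y.
apply/implyP => /(implyP (genS x y))/leq_trans; apply.
by rewrite subset_leq_card // setSI.
Qed.

Lemma adim_min (V : finType) (k : nat) (G : sgraph V) (S : {set V}) :
  adj_generator G k S -> adim G k <= #|S|.
Proof.
(* The default [[set: V]] of the arg min must itself be a generator; it is one because it contains
   [S]. *)
move=> genS; rewrite /adim; case: arg_minnP => [|T _]; last exact.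
exact: adj_generator_sub (subsetT S) genS.
Qed.

Theorem theorem21 (V : finType) (k : nat) (G G' : sgraph V) (B : {set V})
  (hB : adj_basis G k B)
  (hN : forall x : V, x \in B -> neigh G' x = neigh G x) :
  adj_generator G' k B /\ adim G' k <= adim G k.
Proof.
have /andP[genB _] := hB; have genB' := adj_generator_neigh hN genB.
by rewrite (adim_basis hB); split; last exact: adim_min.
Qed.
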